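(* Suppose that for some singular cardinal $\kappa$ of countable cofinality, the set $[\kappa]^\omega$ contains a locally countable family of cardinality $>\kappa$. Then there is a Corson compactum $X$ such that $c(X^\omega)=\kappa < d(X)$; in particular $X^\omega$ has no dense metrizable subspace.
   Context: $[\kappa]^\omega$ is the set of countable (infinite) subsets of $\kappa$. A family $\mathcal{F}$ of countable sets is locally countable if for every uncountable subfamily $\mathcal{G}\subseteq\mathcal{F}$ the set $\bigcup\mathcal{G}$ is uncountable. A compact Hausdorff space $X$ is a Corson compactum if for some cardinal $\lambda$ it is homeomorphic to a subspace of $\Sigma(\mathbb{R}^\lambda)=\{x \in \mathbb{R}^\lambda : |\{\alpha<\lambda: x(\alpha)\neq 0\}| \leq \aleph_0\}$. $c(Z)$ is the cellularity (supremum of cardinalities of families of pairwise disjoint non-empty open sets) and $d(Z)$ the density of $Z$. *)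

(* Defs.v *)
From HB Require Import structures.
From mathcomp Require Import all_boot all_order all_algebra.
From mathcomp Require Import all_classical all_reals all_analysis.
Set Implicit Arguments. Unset Strict Implicit. Unset Printing Implicit Defensive.
Import Order.TTheory GRing.Theory Num.Theory.
Import numFieldNormedType.Exports.
Local Open Scope classical_set_scope.
Local Open Scope card_scope.
Local Open Scope ring_scope.

(* Cardinals are represented by (subsets of) types; |A| <= |B| is [A #<= B]. *)

Definition singular_countable_cof (K : Type) : Prop :=
  ~ countable [set: K] /\
  exists A : nat -> set K,
    (forall n, ~ ([set: K] #<= A n)) /\ \bigcup_n A n = [set: K].

Definition countable_subsets (K : Type) : set (set K) :=
  [set A | countable A /\ infinite_set A].

Definition locally_countable (K : Type) (F : set (set K)) : Prop :=
  forall G : set (set K), G `<=` F -> ~ countable G ->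
    ~ countable (\bigcup_(A in G) A).

Definition Sigma_product (R : realType) (L : Type) : set {ptws L -> R} :=
  [set x | countable [set a | x a != 0]].

Definition embedding (X Y : topologicalType) (f : X -> Y) : Prop :=
  continuous f /\ injective f /\
  forall U : set X, open U ->
    exists V : set Y, open V /\ f @` U = f @` [set: X] `&` V.

Definition Corson_compact (R : realType) (X : topologicalType) : Prop :=
  compact [set: X] /\ hausdorff_space X /\
  exists (L : Type) (f : X -> {ptws L -> R}),
    embedding f /\ f @` [set: X] `<=` @Sigma_product R L.

Definition cellular_family (Z : topologicalType) (U : set (set Z)) : Prop :=
  (forall O, U O -> open O /\ O !=set0) /\
  (forall O1 O2, U O1 -> U O2 -> O1 <> O2 -> O1 `&` O2 = set0).

(* c(Z) = |K| : sup of cardinalities of cellular families equals |K|,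
   i.e. every cellular family has size <= |K|, and no cardinal mu < |K|
   (mu = |M|, M a subset of K with |M| < |K|) bounds all of them. *)
Definition cellularity_eq (Z : topologicalType) (K : Type) : Prop :=
  (forall U : set (set Z), cellular_family U -> U #<= [set: K]) /\
  (forall M : set K, ~ ([set: K] #<= M) ->
     ~ (forall U : set (set Z), cellular_family U -> U #<= M)).

Definition density_gt (Z : topologicalType) (K : Type) : Prop :=
  forall D : set Z, dense D -> ~ (D #<= [set: K]).

Definition metrizable_subspace (R : realType) (Z : topologicalType)
  (D : set Z) : Prop :=
  exists d : Z -> Z -> R,
    (forall x y, D x -> D y -> 0 <= d x y) /\
    (forall x y, D x -> D y -> (d x y = 0 <-> x = y)) /\
    (forall x y, D x -> D y -> d x y = d y x) /\
    (forall x y z, D x -> D y -> D z -> d x z <= d x y + d y z) /\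
    (forall A : set Z, A `<=` D ->
      ((exists O : set Z, open O /\ A = D `&` O) <->
       (forall x, A x -> exists e : R, 0 < e /\
          [set y | D y /\ d x y < e] `<=` A))).

(* Main.v *)
Require Import Defs.
From HB Require Import structures.
From mathcomp Require Import all_boot all_order all_algebra.
From mathcomp Require Import finmap all_classical all_reals all_analysis.
Set Implicit Arguments. Unset Strict Implicit. Unset Printing Implicit Defensive.
Import Order.TTheory GRing.Theory Num.Theory.
Import numFieldNormedType.Exports.
Local Open Scope classical_set_scope.
Local Open Scope card_scope.

(** Enumerate each member of the family [F] as a sequence in [K], and let [S]
    be the set of these sequences together with all constant ones. Call a set
    of sequences slim if, for each [n > 0], its members have at most [n]
    distinct restrictions to [{0, ..., n-1}]. The slim subsets of [S] form a
    closed subspace [X] of [{0,1}^S]. The values taken by the members of a slim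
    set form a countable set, so slim sets are countable by local
    countability, and [X] is Corson. A dense subset of [X] of size at most [|K|]
    would cover [S] by at most [|K|] countable supports, so [d(X) > |K|].

    Nevertheless [X^omega] has no cellular family larger than [K]: code a basic
    open set by restricting the finitely many sequences it mentions to a length
    [n] that separates them and is at least twice their number. There are only
    [|K|] codes, and two basic sets with the same code meet, because in the
    union of the two slim supports nothing new is seen below level [n], while
    above it the bound exceeds the size of the union. Conversely, the constant
    sequences, being pairwise incompatible at level 1, yield a cellular family
    of size [|K|].

    A dense metrizable subspace would have a dense subset of size at most
    [c(X^omega) = |K|], which projects to a dense subset of [X]. *)

(** * Cardinal arithmetic *)

Lemma card_leT_injP {T U : Type} (A : set T) (u0 : U) :
  A #<= [set: U] <->
  exists f : T -> U, forall x y, A x -> A y -> f x = f y -> x = y.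
Proof.
pose isPU := isPointed.Build {classic U} u0.
pose pU : pointedType := HB.pack {classic U} isPU.
split=> [|[f fI]].
  move=> /(@pcard_injP _ pU)[f fI]; exists f => x y Ax Ay.
  by apply: fI; rewrite inE.
apply/(@pcard_injP _ pU); exists f => x y; rewrite !inE; exact: fI.
Qed.

(** Comparability of cardinals: a partial bijection that is maximal by Zorn's lemma exhausts one
    side, since otherwise an unmatched pair could be added. *)
Lemma set_comparable {T U : Type} (A : set T) (B : set U) :
  exists R : T -> U -> Prop,
  [/\ forall x y y', R x y -> R x y' -> y = y',
      forall x x' y, R x y -> R x' y -> x = x',
      forall x y, R x y -> A x /\ B y &
      (forall x, A x -> exists y, R x y) \/ (forall y, B y -> exists x, R x y)].
Proof.
pose P (R : set (T * U)) :=
  [/\ forall x y y', R (x, y) -> R (x, y') -> y = y',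
      forall x x' y, R (x, y) -> R (x', y) -> x = x' &
      forall x y, R (x, y) -> A x /\ B y].
have [F FP Ftot|R [[Rfun Rinj RAB] Rmax]] := @Zorn_bigcup _ P.
  have dir t t' : (\bigcup_(X in F) X) t -> (\bigcup_(X in F) X) t' ->
      exists X, [/\ F X, X t & X t'].
    move=> [X FX Xt] [Y FY Yt'].
    by have [XY|YX] := Ftot _ _ FX FY; [exists Y|exists X]; split=> //;
      [apply: XY|apply: YX].
  split.
  - move=> x y y' h h'; have [X [FX]] := dir _ _ h h'.
    by have [+ _ _] := FP _ FX; apply.
  - move=> x x' y h h'; have [X [FX]] := dir _ _ h h'.
    by have [_ + _] := FP _ FX; apply.
  - by move=> x y [X FX]; have [_ _] := FP _ FX; apply.
exists (fun x y => R (x, y)); split=> //.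
apply: contrapT => /not_orP[/existsNP[a /not_implyP[Aa na]]].
move=> /existsNP[b /not_implyP[Bb nb]].
apply: (Rmax (R `|` [set (a, b)])).
  split=> [?|sub]; first by left.
  by apply: na; exists b; apply: sub; right.
split.
- move=> x y y' [h [h'|[e1 e2]]|[e1 e2] [h'|[e1' e2']]]; subst => //.
  + exact: Rfun h h'.
  + by case: na; exists y.
  + by case: na; exists y'.
- move=> x x' y [h [h'|[e1 e2]]|[e1 e2] [h'|[e1' e2']]]; subst => //.
  + exact: Rinj h h'.
  + by case: nb; exists x.
  + by case: nb; exists x'.
- by move=> x y [/RAB//|[-> ->]].
Qed.

Section Square.
Variable K : Type.

(* Zorn's lemma is applied to graphs of injections [A * A -> A]; two distinct
   points of [A] serve as tags. *)
Let graph (A : set K) (p : K -> K -> K) : set (K * K * K) :=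
  [set t | [/\ A t.1.1, A t.1.2 & t.2 = p t.1.1 t.1.2]].

Let pairing (A : set K) (p : K -> K -> K) :=
  [/\ exists c0 c1, [/\ A c0, A c1 & c0 <> c1],
      forall x y, A x -> A y -> A (p x y) &
      forall x y x' y', A x -> A y -> A x' -> A y' -> p x y = p x' y' ->
        x = x' /\ y = y'].

Let P R := R = set0 \/ exists A p, pairing A p /\ R = graph A p.

Let P_bigcup (F : set (set (K * K * K))) :
  F `<=` P -> total_on F subset -> P (\bigcup_(X in F) X).
Proof.
move=> FP Ftot; set G := \bigcup_(X in F) X.
have [->|/eqP/set0P[t0 Gt0]] := pselect (G = set0); first by left.
have dir t t' : G t -> G t' ->
    exists A p, [/\ pairing A p, F (graph A p), graph A p t & graph A p t'].
  move=> [X FX Xt] [Y FY Yt'].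
  have [Z [FZ Zt Zt']] : exists Z, [/\ F Z, Z t & Z t'].
    by have [XY|YX] := Ftot _ _ FX FY; [exists Y|exists X]; split=> //;
      [apply: XY|apply: YX].
  have [Z0|[A [p [Ap eZ]]]] := FP _ FZ; first by move: Zt; rewrite Z0.
  by exists A, p; split=> //; rewrite -eZ.
(* Each graph lives on a full square, so the carrier of the union can be read off the diagonal. *)
pose D x := exists z, G (x, x, z).
have GF A' p' t : F (graph A' p') -> graph A' p' t -> G t.
  by move=> FX; exists (graph A' p').
have Dmem A' p' x : F (graph A' p') -> A' x -> D x.
  by move=> FX Ax; exists (p' x x); apply: GF FX _.
have dirD x y : D x -> D y -> exists A' p', [/\ pairing A' p', F (graph A' p'), A' x & A' y].
  move=> [z h] [z' h']; have [A' [p' [? ? [/= ? ? ?] [/= ? ? ?]]]] := dir _ _ h h'.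
  by exists A', p'.
have Gfun x y z z' : G (x, y, z) -> G (x, y, z') -> z = z'.
  by move=> h h'; have [A' [p' [_ _ [/= _ _ ->] [/= _ _ ->]]]] := dir _ _ h h'.
have GD x y z : G (x, y, z) -> [/\ D x, D y & D z].
  move=> h; have [A' [p' [pA FX [/= Ax Ay ->] _]]] := dir _ _ h h.
  have [_ pc _] := pA.
  by split; apply: (Dmem _ _ _ FX) => //; apply: pc.
have ex x y : exists z, D x -> D y -> G (x, y, z).
  have [[Dx Dy]|nD] := pselect (D x /\ D y).
    have [A' [p' [pA FX Ax Ay]]] := dirD _ _ Dx Dy.
    by exists (p' x y) => _ _; apply: GF FX _.
  by exists x => Dx Dy; case: nD.
pose p x y := projT1 (cid (ex x y)).
have pP x y : D x -> D y -> G (x, y, p x y) := projT2 (cid (ex x y)).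
right; exists D, p; split; first split.
- have [A' [p' [pA FX _ _]]] := dir _ _ Gt0 Gt0.
  have [[c0 [c1 [A0 A1 c01]]] _ _] := pA.
  by exists c0, c1; split=> //; apply: Dmem FX _.
- by move=> x y Dx Dy; have [] := GD _ _ _ (pP _ _ Dx Dy).
- move=> x y x' y' Dx Dy Dx' Dy' e.
  have h := pP _ _ Dx Dy; have h' := pP _ _ Dx' Dy'; rewrite -e in h'.
  have [A' [p' [[_ _ pI] FX [/= ? ? ez] [/= ? ? ez']]]] := dir _ _ h h'.
  by apply: pI => //; rewrite -ez -ez'.
- apply/seteqP; split=> [[[x y] z] h|[[x y] z] [/= Dx Dy ->]]; last exact: pP.
  have [Dx Dy _] := GD _ _ _ h; split=> //=.
  by apply: Gfun h _; apply: pP.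
Qed.

(** Idempotence of infinite cardinals. Take a maximal pairing, on [A] say. If the complement of [A]
    injects into [A], then so does [K], by [v], and the pairing transports to [K]; otherwise a copy
    of [A] in the complement lets it be extended. *)
Lemma infinite_pairing : infinite_set [set: K] ->
  exists p : K -> K -> K, forall x y x' y', p x y = p x' y' -> x = x' /\ y = y'.
Proof.
move=> infK; have [k0 _] := infinite_setN0 infK.
have /infiniteP/(card_leT_injP _ k0)[i iI'] := infK.
have {}iI : injective i by move=> m n; apply: iI'.
have [R [PR Rmax]] := Zorn_bigcup P_bigcup.
have [A [p [pA eR]]] : exists A p, pairing A p /\ R = graph A p.
  (* The empty graph is not maximal: the countable set [range i] carries a pairing. *)
  case: PR => // R0; exfalso.
  pose A := range i; pose r k := xget 0%N [set n | i n = k].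
  have rK n : r (i n) = n.
    by apply: iI; rewrite /r; apply: (@xgetPex _ 0%N [set m | i m = i n]); exists n.
  pose p x y := i (choice.pickle (r x, r y)).
  apply: (Rmax (graph A p)).
    rewrite R0; split=> // sub; apply: (sub (i 0%N, i 0%N, p (i 0%N) (i 0%N))).
    by split=> //=; exists 0%N.
  right; exists A, p; split=> //; split.
  - exists (i 0%N), (i 1%N); split; [by exists 0%N|by exists 1%N|by move=> /iI].
  - by move=> x y _ _; exists (choice.pickle (r x, r y)).
  - move=> _ _ _ _ [m _ <-] [n _ <-] [m' _ <-] [n' _ <-].
    rewrite /p !rK => /iI e.
    by have := congr1 (@choice.unpickle (nat * nat)%type) e; rewrite !choice.pickleK => -[-> ->].
have [[c0 [c1 [A0 A1 c01]]] pc pI] := pA.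
have [E [Efun Einj EAB Etot]] := set_comparable A (~` A).
(* [v] embeds [A] together with the partner under [E] of each point of [A] into [A]. *)
pose v x := if pselect (A x) is left _ then p c0 x
            else if pselect (exists a, E a x) is left e then p c1 (projT1 (cid e))
            else c0.
have vL x : A x -> v x = p c0 x by rewrite /v; case: pselect.
have vR a b : E a b -> v b = p c1 a.
  move=> Eab; have [Aa nAb] := EAB _ _ Eab.
  rewrite /v; case: pselect => // _; case: pselect => [e|[]]; last by exists a.
  by congr p; apply: (Einj _ _ b) => //; exact: projT2 (cid e).
pose D x := A x \/ exists a, E a x.
have vA x : D x -> A (v x).
  by move=> [Ax|[a h]]; [rewrite vL//|rewrite (vR _ _ h)]; apply: pc => //;
    have [] := EAB _ _ h.
have vI x y : D x -> D y -> v x = v y -> x = y.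
  move=> [Ax|[a h]] [Ay|[b h']].
  - by rewrite !vL// => /pI[].
  - have [Ab _] := EAB _ _ h'.
    by rewrite (vL _ Ax) (vR _ _ h') => /pI[].
  - have [Aa _] := EAB _ _ h.
    by rewrite (vL _ Ay) (vR _ _ h) => /pI[]// /esym.
  - have [Aa _] := EAB _ _ h; have [Ab _] := EAB _ _ h'.
    rewrite (vR _ _ h) (vR _ _ h') => /pI[]// _ ab; subst b.
    exact: Efun h h'.
have [Eall|Esurj] := Etot; last first.
  have DT x : D x by have [?|/Esurj] := pselect (A x); [left|right].
  exists (fun x y => p (v x) (v y)) => x y x' y' /pI[]; try exact: vA.
  by move=> /vI-> // /vI->.
exfalso.
have [h hP] : exists h, forall a, A a -> E a (h a).
  have /choice[h hP] : forall a, exists b, A a -> E a b.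
    move=> a; have [/Eall[b Eb]|nA] := pselect (A a); first by exists b.
    by exists a.
  by exists h.
have hD a : A a -> D (h a) by move=> /hP ?; right; exists a.
have hN a : A a -> ~ A (h a) by move=> /hP/EAB[].
have hI a a' : A a -> A a' -> h a = h a' -> a = a'.
  by move=> /hP Ea /hP Ea' e; apply: Einj Ea _; rewrite e.
(* Pairs from [A] keep their value; all others go into the image of [A] under [h], which is disjoint
   from [A]. *)
pose q x y := if pselect (A x /\ A y) is left _ then p x y
              else h (p (v x) (v y)).
have qL x y : A x -> A y -> q x y = p x y.
  by rewrite /q => Ax Ay; case: pselect => // -[].
apply: (Rmax (graph D q)).
  rewrite eR; split=> [[[x y] z] [/= Ax Ay ->]|sub].
    by split; [by left|by left|rewrite qL].
  have : graph D q (h c0, h c0, q (h c0) (h c0)) by split=> //=; apply: hD.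
  by move=> /sub[/= /(hN _ A0)].
have qA x y : D x -> D y -> A (p (v x) (v y)).
  by move=> Dx Dy; apply: pc; apply: vA.
right; exists D, q; split=> //; split.
- by exists c0, c1; split=> //; left.
- move=> x y Dx Dy; rewrite /q; case: pselect => [[Ax Ay]|_]; first by left; exact: pc.
  by apply: hD; exact: qA.
- move=> x y x' y' Dx Dy Dx' Dy'; rewrite /q.
  case: pselect => [[Ax Ay]|nA]; case: pselect => [[Ax' Ay']|nA'].
  + exact: pI.
  + by move=> e; case: (hN _ (qA _ _ Dx' Dy')); rewrite -e; exact: pc.
  + by move=> e; case: (hN _ (qA _ _ Dx Dy)); rewrite e; exact: pc.
  + move=> /hI e; have {e} := e (qA _ _ Dx Dy) (qA _ _ Dx' Dy').
    by move=> /pI[]; try exact: vA; move=> /vI-> // /vI->.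
Qed.

End Square.

Definition injects (T U : Type) := exists f : T -> U, injective f.

Section InfiniteType.
Variable K : Type.
Hypothesis infK : infinite_set [set: K].

Lemma injects_countType (C : countType) : injects C K.
Proof.
have [k0 _] := infinite_setN0 infK.
have /infiniteP/(card_leT_injP _ k0)[i iI] := infK.
exists (i \o choice.pickle); apply: inj_comp; first by move=> m n; apply: iI.
exact: pcan_inj choice.pickleK.
Qed.

Lemma injects_prod (T U : Type) : injects T K -> injects U K -> injects (T * U) K.
Proof.
move=> [f fI] [g gI]; have [p pI] := infinite_pairing infK.
by exists (fun t => p (f t.1) (g t.2)) => -[x y] [x' y'] /pI[/= /fI-> /gI->].
Qed.

Lemma injects_seq (T : Type) : injects T K -> injects (seq T) K.
Proof.
move=> [f fI]; have [p pI] := infinite_pairing infK.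
have [i iI] := injects_countType nat; pose enc := foldr (fun x => p (f x)) (i 0%N).
(* The length is stored separately because the starting value of the fold may also encode a longer
   list. *)
exists (fun l => p (i (size l)) (enc l)) => l l' /pI[/iI].
elim: l l' => [[]//|x l IH] [|x' l']//= [sl] /pI[/fI-> /= e].
by rewrite (IH l').
Qed.

Lemma card_leT_injects (T U : Type) (A : set T) :
  injects U K -> A #<= [set: U] -> A #<= [set: K].
Proof.
move=> [f fI] AU; apply: card_le_trans AU _.
have [k0 _] := infinite_setN0 infK.
by apply/(card_leT_injP _ k0); exists f => x y _ _; exact: fI.
Qed.

End InfiniteType.

(** * Slim sets of sequences *)

Section Slim.
Variable K : choiceType.
Implicit Types (s t : nat -> K) (l : seq (nat -> K)).

(** Lists stand for finite sets. Level 0 is left out: all sequences share the empty restriction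
    there, and the bound would be 0. *)
Definition slim l :=
  forall n, (0 < n)%N -> (size (undup [seq mkseq s n | s <- l]) <= n)%N.

Lemma mkseq_eq_le s t m n : (m <= n)%N -> mkseq s n = mkseq t n ->
  mkseq s m = mkseq t m.
Proof. by move=> /minn_idPl mn; rewrite /mkseq -mn -take_iota !map_take => ->. Qed.

Lemma mkseq_separates l : exists N, forall n, (N <= n)%N ->
  forall s t, s \in l -> t \in l -> mkseq s n = mkseq t n -> s = t.
Proof.
have /choice[m mP] : forall st : (nat -> K) * (nat -> K),
    exists m, st.1 <> st.2 -> st.1 m <> st.2 m.
  move=> [s t]; have [->|st] := pselect (s = t); first by exists 0%N.
  have /existsNP[i ?] : ~ forall i, s i = t i by move=> /funext.
  by exists i.
exists (\max_(st <- [seq (s, t) | s <- l, t <- l]) (m st).+1) => n Nn s t sl tl e.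
apply: contrapT => st; apply: (mP (s, t) st) => /=.
have mn : (m (s, t) < n)%N.
  apply: leq_trans Nn; apply: (@leq_bigmax_seq _ _ xpredT (fun st => (m st).+1)) => //.
  exact: allpairs_f.
by have := congr1 (fun u => nth (s 0%N) u (m (s, t))) e; rewrite !nth_mkseq.
Qed.

Lemma slim_sub1 s l : {subset l <= [:: s]} -> slim l.
Proof.
move=> ls n n0; apply: leq_trans n0.
apply: (@uniq_leq_size _ _ [:: mkseq s n]); first exact: undup_uniq.
move=> x; rewrite mem_undup => /mapP[t /ls]; rewrite inE => /eqP-> ->.
exact: mem_head.
Qed.

(** Below level [n], [l2] brings no restriction that [l1] lacks; from level [n] on, the number of
    sequences is itself within the bound. *)
Lemma slim_merge n l1 l2 l : (size l1 + size l2 <= n)%N -> slim l1 ->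
  (forall s, s \in l2 -> exists2 t, t \in l1 & mkseq s n = mkseq t n) ->
  {subset l <= l1 ++ l2} -> slim l.
Proof.
move=> ln ok1 l12 sub m m0; have [nm|mn] := leqP n m.
  apply: leq_trans nm; apply: leq_trans ln.
  rewrite -size_cat -(size_map (fun s => mkseq s m)).
  apply: uniq_leq_size; first exact: undup_uniq.
  by move=> x; rewrite mem_undup => /mapP[s /sub sl ->]; exact: map_f.
apply: leq_trans (ok1 m m0); apply: uniq_leq_size; first exact: undup_uniq.
move=> x; rewrite !mem_undup => /mapP[s /sub + ->]; rewrite mem_cat.
move=> /orP[sl|/l12[t tl st]]; first exact: map_f.
by rewrite (mkseq_eq_le (ltnW mn) st); exact: map_f.
Qed.

Lemma slim_const k k' : slim [:: fun=> k; fun=> k'] -> k = k'.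
Proof.
move=> /(_ 1%N isT)/=; rewrite /mkseq/= inE; case: eqP => [[]//|_].
by rewrite ltnn.
Qed.

Lemma slim_countable (G : set (nat -> K)) :
  (forall l, (forall s, s \in l -> G s) -> slim l) ->
  countable (\bigcup_(s in G) range s).
Proof.
move=> Gslim; pose T n := (fun s => mkseq s n) @` G.
have finT n : (0 < n)%N -> finite_set (T n).
  move=> n0; apply: contrapT => infT.
  have [_ [s0 Gs0 _]] := infinite_setN0 infT.
  (* Members of [G] lifting more than [n] distinct restrictions would form a list that is not
     slim. *)
  have [X XT nX] := infinite_set_fset n.+1 infT.
  have /choice[f fP] : forall u, exists s, u \in X -> G s /\ mkseq s n = u.
    move=> u; have [uX|_] := boolP (u \in X); last by exists s0.
    by have [s ? ?] := XT _ uX; exists s.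
  have Gl s : s \in [seq f u | u <- enum_fset X] -> G s.
    by move=> /mapP[u /fP[? _] ->].
  have := Gslim _ Gl n n0; rewrite leqNgt -map_comp => /negP; apply.
  rewrite (@eq_in_map _ _ _ id _).1 ?map_id; last by move=> u /fP[].
  by rewrite undup_id// fset_uniq.
(* The value at [n] is read from the restriction of length [n.+1], so only positive levels occur. *)
apply: (@sub_countable _ _ _ (\bigcup_n \bigcup_(u in T n.+1) [set` u])).
  apply: subset_card_le => k [s Gs [n _ <-]].
  exists n => //; exists (mkseq s n.+1); first by exists s.
  by apply/mapP; exists n; rewrite // mem_iota/= add0n.
apply: bigcup_countable => // n _; apply: bigcup_countable.
  exact: finite_set_countable (finT _ _).
by move=> u _; exact: finite_set_countable (finite_seq u).
Qed.

End Slim.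

(** * The compactum *)

Local Open Scope ring_scope.

Lemma cvg_ptws (I : Type) (T : topologicalType) (F : set_system {ptws I -> T})
  (p : {ptws I -> T}) : Filter F ->
  (forall i, (fun g : {ptws I -> T} => g i) @ F --> p i) -> F --> p.
Proof.
move=> FF Fp; apply/cvg_sup => i A [_ [[B oB <-] Bp] BA].
apply: filterS BA _; apply: (Fp i); exact: open_nbhs_nbhs.
Qed.

Lemma ptws_proj_continuous (I : Type) (T : topologicalType) (i : I) :
  continuous (fun g : {ptws I -> T} => g i).
Proof. exact: (@proj_continuous {classic I} (fun=> T) i). Qed.

Lemma ptws_hausdorff (I : Type) (T : topologicalType) :
  hausdorff_space T -> hausdorff_space {ptws I -> T}.
Proof. by move=> hT; apply: (@hausdorff_product {classic I} (fun=> T)). Qed.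

Lemma set_type_hausdorff (T : topologicalType) (A : set T) :
  hausdorff_space T -> hausdorff_space A.
Proof.
move=> hT x y xy; apply: val_inj; apply: hT => U V Ux Vy.
have [z [Uz Vz]] := xy _ _ (@initial_continuous _ _ set_val x _ Ux)
                       (@initial_continuous _ _ set_val y _ Vy).
by exists (set_val z).
Qed.

Lemma set_type_embedding (T : topologicalType) (A : set T) :
  embedding (set_val : A -> T).
Proof.
split; first exact: initial_continuous.
split; first exact: val_inj.
move=> _ [V oV <-]; exists V; split=> //; apply/seteqP; split.
  by move=> _ [x Vx <-]; split => //; exists x.
by move=> _ [[x _ <-] Vx]; exists x.
Qed.

Lemma set_type_compact (T : topologicalType) (A : set T) :
  compact A -> compact [set: A].
Proof.
move=> cA F FF _.
have FA : (set_val @ F) A.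
  by apply: (@filterS _ F _ setT) => [x _ /=|]; [exact: set_valP|exact: filterT].
have [t [At tF]] := cA (set_val @ F) _ FA.
exists (SigSub (mem_set At)); split; [exact: Logic.I|move=> B C FB].
move=> [_ [[V oV <-] Vt] VC].
have FB' : (set_val @ F) (set_val @` B) by apply: (@filterS _ F _ B) => // x Bx /=; exists x.
have [_ [[z Bz <-] Vz]] := tF _ _ FB' (open_nbhs_nbhs (conj oV Vt)).
by exists z; split=> //; apply: VC.
Qed.

Section SlimSpace.
Variables (R : realType) (K : choiceType) (S : set (nat -> K)).
Local Notation L := (nat -> K).

(* The last condition says that finite subsets of the support are slim, in a form
   that is visibly closed. *)
Definition slim_space : set {ptws L -> R} :=
  [set x | [/\ forall s, x s = 0 \/ x s = 1,
               forall s, ~ S s -> x s = 0 &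
               forall l : seq L, ~ slim l -> exists2 s, s \in l & x s = 0]].

Local Notation X := (set_type slim_space).

(** The space is closed in a Tychonoff cube: each list that is not slim contributes a finite union
    of closed sets. *)
Lemma slim_space_compact : compact slim_space.
Proof.
have cl0 (s : L) : closed [set x : {ptws L -> R} | x s = 0].
  apply: (@preimage_closed _ _ (fun x : {ptws L -> R} => x s) [set 0]).
    by move=> x _; exact: ptws_proj_continuous.
  exact: closed_eq.
have cpt : compact [set x : {ptws L -> R} | forall s, ([set 0] `|` [set 1]) (x s)].
  apply: (@tychonoff L (fun=> R) (fun=> [set 0] `|` [set 1])) => _.
  by apply: compactU; exact: compact_set1.
apply: (subclosed_compact _ cpt); last by move=> x [].
rewrite (_ : slim_space = [set x | forall s, ([set 0] `|` [set 1]) (x s)] `&`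
  (\bigcap_(s in ~` S) [set x | x s = 0] `&`
   \bigcap_(l in [set l : seq L | ~ slim l]) \bigcup_(s in [set` l]) [set x | x s = 0])).
  apply: closedI; first by apply: compact_closed => //; apply: ptws_hausdorff; exact: Rhausdorff.
  apply: closedI; first by apply: closed_bigI => s _.
  apply: closed_bigI => l _; apply: closed_bigcup => //.
  exact: finite_seq.
by apply/seteqP; split=> [x [? ? h]|x [? [? h]]]; split=> // l /h.
Qed.

Lemma slim_space_out (x : X) (s : L) : ~ S s -> set_val x s = 0.
Proof. by move=> nS; have [_ /(_ _ nS)] := set_valP x. Qed.

Lemma slim_space_supp (x : X) (l : seq L) :
  (forall s, s \in l -> set_val x s <> 0) -> slim l.
Proof.
move=> nz; have [_ _ h] := set_valP x.
by apply: contrapT => /h[s /nz].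
Qed.

(** The inclusion lands in the Sigma-product: finite subsets of a support are slim, so its members
    take countably many values in all, and the hypothesis makes the support countable. *)
Lemma slim_space_Corson :
  (forall G, G `<=` S -> countable (\bigcup_(s in G) range s) -> countable G) ->
  Corson_compact R X.
Proof.
move=> cS; split; first exact: set_type_compact slim_space_compact.
split; first by apply: set_type_hausdorff; apply: ptws_hausdorff; exact: Rhausdorff.
exists L, set_val; split; first exact: set_type_embedding.
move=> _ [x _ <-]; apply: cS => [s /= /eqP xs|].
  by apply: contrapT => /(slim_space_out x).
by apply: slim_countable => l nz; apply: (@slim_space_supp x) => s /nz/eqP.
Qed.

Lemma slim_indicator (l : seq L) : (forall s, s \in l -> S s) ->
  (forall l', {subset l' <= l} -> slim l') ->
  slim_space (fun s => (s \in l)%:R).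
Proof.
move=> lS lslim; split.
- by move=> s; case: (s \in l); [right|left].
- by move=> s nS; case: (boolP (s \in l)) => // /lS.
- move=> l' nl'; apply: contrapT => n0; apply: nl'; apply: lslim => s sl'.
  by apply: contrapT => /negP/negPf sl; apply: n0; exists s; rewrite // sl.
Qed.

Lemma slim_point (s : L) : S s -> exists x : X, set_val x s <> 0.
Proof.
move=> Ss; have sp : slim_space (fun t => (t \in [:: s])%:R).
  by apply: slim_indicator => [t|l' /slim_sub1//]; rewrite inE => /eqP->.
exists (SigSub (mem_set sp)); rewrite set_valE/= mem_head.
  by apply/eqP; exact: oner_neq0.
Qed.

Lemma open_supp (s : L) : open [set x : X | set_val x s <> 0].
Proof.
apply: (@open_comp X R (fun x => set_val x s) (~` [set 0])).
  move=> x _; apply: (@continuous_comp X {ptws L -> R} R set_val (fun y => y s)).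
    exact: initial_continuous.
  exact: ptws_proj_continuous.
by apply: closed_openC; exact: closed_eq.
Qed.

(** The sets containing a cylinder around [p] form a filter, and it converges to [p] because it does
    so coordinate by coordinate. *)
Lemma slim_space_cylinder (O : set {ptws nat -> X}) (p : {ptws nat -> X}) :
  open O -> O p -> exists w : seq (nat * L),
  forall y : {ptws nat -> X},
    (forall i s, (i, s) \in w -> set_val (y i) s = set_val (p i) s) -> O y.
Proof.
move=> oO Op.
pose F : set_system {ptws nat -> X} := [set U | exists w : seq (nat * L),
  forall y : {ptws nat -> X},
    (forall i s, (i, s) \in w -> set_val (y i) s = set_val (p i) s) -> U y].
have FF : Filter F.
  split; first by exists [::].
    move=> U V [w wU] [w' wV]; exists (w ++ w') => y yw; split.
      by apply: wU => i s h; apply: yw; rewrite mem_cat h.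
    by apply: wV => i s h; apply: yw; rewrite mem_cat h orbT.
  by move=> U V UV [w wU]; exists w => y /wU/UV.
suff Fp : F --> p by apply: Fp; exact: open_nbhs_nbhs.
apply: cvg_ptws => i U [_ [[V oV <-] Vp] VU].
suff : (set_val \o (fun g : {ptws nat -> X} => g i)) @ F --> (set_val (p i) : {ptws L -> R}).
  move=> /(_ V) h; have : nbhs (set_val (p i)) V by exact: open_nbhs_nbhs.
  move=> /h FV; apply: (@filterS _ F FF _ _ _ FV).
  by move=> y /= Vy; exact: VU.
apply: cvg_ptws => s W /nbhs_singleton Wp.
by exists [:: (i, s)] => y yp /=; rewrite yp// mem_head.
Qed.

End SlimSpace.
Arguments slim_space R {K} S.

(** * Cellularity and density *)

Section SlimPower.
Variables (R : realType) (K : choiceType) (S : set (nat -> K)).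
Local Notation L := (nat -> K).
Local Notation X := (set_type (slim_space R S)).
Local Notation Z := {ptws nat -> X}.
Implicit Types (p : Z) (w : seq (nat * L)).

(** The bit records whether the sequence lies in the support of [p] at that coordinate. *)
Let code p w n : nat * seq (nat * seq K * bool) :=
  (n, [seq (u.1, mkseq u.2 n, set_val (p u.1) u.2 == 1) | u <- w]).

Let pos p w i := [seq u.2 | u <- w & (u.1 == i) && (set_val (p i) u.2 == 1)].

Let mem_pos p w i s :
  (s \in pos p w i) = ((i, s) \in w) && (set_val (p i) s == 1).
Proof.
apply/mapP/andP => [[[j t]]|[sw ps]]; last by exists (i, s); rewrite // mem_filter eqxx ps.
by rewrite mem_filter /= => /andP[/andP[/eqP-> ?] ?] ->.
Qed.

Let separated w n :=
  forall u u', u \in w -> u' \in w -> mkseq u.2 n = mkseq u'.2 n -> u.2 = u'.2.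

Let code_pos p w p' w' n i s : code p w n = code p' w' n ->
  s \in pos p w i -> exists2 t, t \in pos p' w' i & mkseq s n = mkseq t n.
Proof.
move=> [e]; rewrite mem_pos => /andP[sw ps].
have : (i, mkseq s n, true) \in [seq (u.1, mkseq u.2 n, set_val (p u.1) u.2 == 1) | u <- w].
  by apply/mapP; exists (i, s); rewrite //= ps.
rewrite e => /mapP[[j t] tw' [-> st pt]]; exists t => //.
by rewrite mem_pos tw' -pt.
Qed.

(** The two conditions do not conflict: a sequence of [w] that [w'] places in the support shares its
    restriction with a positive sequence of [w], and separation identifies them. *)
Let code_neg p w p' w' n i s : code p w n = code p' w' n -> separated w n ->
  (i, s) \in w -> s \in pos p' w' i -> set_val (p i) s = 1.
Proof.
move=> e sep sw s'; have [t] := code_pos (esym e) s'.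
by rewrite mem_pos => /andP[tw /eqP pt] /(sep _ _ sw tw)/= ->.
Qed.

Let slim_val p i s : set_val (p i) s <> 1 -> set_val (p i) s = 0.
Proof. by have [/(_ s)[]] := set_valP (p i). Qed.

Lemma slim_pos p w i l : {subset l <= pos p w i} -> slim l.
Proof.
move=> sub; apply: (@slim_space_supp _ _ _ (p i)) => s /sub.
by rewrite mem_pos => /andP[_ /eqP->]; apply/eqP; exact: oner_neq0.
Qed.

(** At each coordinate [y] is the indicator of both positive parts together: [slim_merge] makes it a
    point of the space, and [code_neg] preserves the prescribed zeros. *)
Lemma code_meet p w p' w' n : code p w n = code p' w' n ->
  separated w n -> separated w' n -> (size w + size w' <= n)%N ->
  exists y : Z, forall i s,
    ((i, s) \in w -> set_val (y i) s = set_val (p i) s) /\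
    ((i, s) \in w' -> set_val (y i) s = set_val (p' i) s).
Proof.
move=> e sep sep' szn; pose l i := pos p w i ++ pos p' w' i.
have lX i : slim_space R S (fun s => (s \in l i)%:R).
  apply: slim_indicator => [s|l' sub].
    rewrite mem_cat !mem_pos => sl; apply: contrapT => nS.
    by move: sl; rewrite !(slim_space_out _ nS) eq_sym oner_eq0 !andbF.
  apply: (@slim_merge _ n (pos p w i) (pos p' w' i)) => //.
  - apply: leq_trans szn; rewrite !size_map !size_filter.
    by apply: leq_add; exact: count_size.
  - exact: (@slim_pos p w i).
  - by move=> s; exact: code_pos (esym e).
suff ly i s : ((i, s) \in w -> (s \in l i)%:R = set_val (p i) s) /\
              ((i, s) \in w' -> (s \in l i)%:R = set_val (p' i) s).
  by exists (fun i => SigSub (mem_set (lX i))) => i s; have := ly i s; rewrite set_valE.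
rewrite /l mem_cat !mem_pos; split=> sw.
  have [ps|/eqP ps] := eqVneq (set_val (p i) s) 1; first by rewrite sw.
  rewrite andbF/= -mem_pos (slim_val ps); case: (boolP (s \in _)) => // s'.
  by case: ps; exact: code_neg e sep sw s'.
have [ps|/eqP ps] := eqVneq (set_val (p' i) s) 1; first by rewrite sw orbT.
rewrite andbF orbF -mem_pos (slim_val ps); case: (boolP (s \in _)) => // s'.
by case: ps; exact: code_neg (esym e) sep' sw s'.
Qed.

Lemma slim_cellular_le (U : set (set Z)) : infinite_set [set: K] ->
  cellular_family U -> U #<= [set: K].
Proof.
move=> infK [Uopen Udisj]; have [k0 _] := infinite_setN0 infK.
have [->|/eqP/set0P[V UV]] := pselect (U = set0); first exact: card_ge0.
have [_ [p0 _]] := Uopen _ UV.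
have /choice[c cP] : forall O : set Z, exists c : Z * seq (nat * L) * nat,
    U O -> [/\ forall y : Z, (forall i s, (i, s) \in c.1.2 ->
                 set_val (y i) s = set_val (c.1.1 i) s) -> O y,
              separated c.1.2 c.2 & (size c.1.2 + size c.1.2 <= c.2)%N].
  move=> O; have [UO|nU] := pselect (U O); last first.
    by exists (p0, [::], 0%N).
  have [oO [p Op]] := Uopen _ UO; have [w wP] := slim_space_cylinder oO Op.
  have [N NP] := mkseq_separates [seq u.2 | u <- w].
  (* Twice the length of [w] leaves room for two conditions, since equal codes come from lists of
     equal length. *)
  exists (p, w, maxn N (size w + size w)) => _; split=> //; last exact: leq_maxr.
  by move=> u u' uw uw'; apply: (NP _ (leq_maxl _ _)); exact: map_f.
pose f O := code (c O).1.1 (c O).1.2 (c O).2.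
apply: (@card_leT_injects _ infK _ (nat * seq (nat * seq K * bool))).
  have injK : injects K K by exists id.
  apply: (injects_prod infK); first exact: injects_countType.
  apply: (injects_seq infK); apply: (injects_prod infK); last exact: injects_countType.
  by apply: (injects_prod infK); [exact: injects_countType|exact: injects_seq].
apply/(card_leT_injP _ (0%N, [::])); exists f => O O' UO UO' e.
apply: contrapT => /(Udisj _ _ UO UO') disj.
have [cO sO zO] := cP _ UO; have [cO' sO' zO'] := cP _ UO'.
have en : (c O').2 = (c O).2 by case: e.
have sz : size (c O').1.2 = size (c O).1.2.
  by have := congr1 (fun z => size z.2) e; rewrite !size_map.
rewrite /f en in e sO'.
have [|y yP] := code_meet e sO sO'; first by rewrite sz.
suff : (O `&` O') y by rewrite disj.
by split; [apply: cO|apply: cO'] => i s; have [] := yP i s.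
Qed.

Lemma const_cellular : (forall k, S (fun=> k)) ->
  forall M : set K,
  (forall U : set (set Z), cellular_family U -> U #<= M) -> [set: K] #<= M.
Proof.
move=> Sk M UM; pose O k := [set z : Z | set_val (z 0%N) (fun=> k) <> 0].
have On0 k : O k !=set0.
  by have [x xk] := slim_point R (Sk k); exists (fun=> x).
have Odisj k k' : O k `&` O k' !=set0 -> k = k'.
  move=> [z [zk zk']]; apply: slim_const; apply: (@slim_space_supp _ _ _ (z 0%N)) => s.
  by rewrite !inE => /orP[]/eqP->.
have OI : injective O.
  by move=> k k' e; apply: Odisj; rewrite -e setIid.
have UO : cellular_family (range O).
  split=> [_ [k _ <-]|_ _ [k _ <-] [k' _ <-] kk']; last first.
    by apply: contrapT => /eqP/set0P/Odisj kk; apply: kk'; rewrite kk.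
  split=> //.
  apply: (@open_comp Z X (fun z : Z => z 0%N) [set x | set_val x (fun=> k) <> 0]).
    by move=> z _; exact: ptws_proj_continuous.
  exact: open_supp.
apply: card_le_trans (UM _ UO).
by have /card_eqPle[_] := @inj_card_eq _ _ [set: K] O (in2W OI).
Qed.

(** Each [s] in [S] is coded by a point of [D] whose support contains [s], together with the index
    of [s] in that countable support. *)
Lemma slim_density : infinite_set [set: K] ->
  (forall G, G `<=` S -> countable (\bigcup_(s in G) range s) -> countable G) ->
  ~ (S #<= [set: K]) -> density_gt X K.
Proof.
move=> infK cS SK D dD DK; apply: SK.
have [k0 _] := infinite_setN0 infK.
have [j jI] := (card_leT_injP _ k0).1 DK.
have cx (x : X) : countable [set s | set_val x s <> 0].
  apply: cS => [s xs|]; first by apply: contrapT => /(slim_space_out x).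
  by apply: slim_countable => l nz; exact: (@slim_space_supp _ _ _ x).
have /choice[i iI] (x : X) : exists i : L -> nat,
    forall s t, set_val x s <> 0 -> set_val x t <> 0 -> i s = i t -> s = t.
  have /countable_injP[i iI] := cx x; exists i => s t xs xt.
  by apply: iI; rewrite inE.
have [->|/eqP/set0P[s0 Ss0]] := pselect (S = set0); first exact: card_ge0.
have [x0 _] := slim_point R Ss0.
have /choice[e eP] : forall s, exists x, S s -> D x /\ set_val x s <> 0.
  move=> s; have [Ss|nS] := pselect (S s).
    have [x [xs Dx]] := dD _ (slim_point R Ss) (@open_supp R K S s).
    by exists x.
  by exists x0.
apply: (@card_leT_injects _ infK _ (K * nat)).
  by apply: injects_prod => //; [exists id|exact: injects_countType].
apply/(card_leT_injP _ (k0, 0%N)); exists (fun s => (j (e s), i (e s) s)) => s t Ss St.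
have [Ds es] := eP _ Ss; have [Dt et] := eP _ St.
move=> [/jI exy ist]; rewrite -exy// in ist et.
exact: iI ist.
Qed.

End SlimPower.

(** * Dense metrizable subspaces *)

(** For each [n], take a maximal set [E n] of centres of disjoint balls of radius [1/(n+1)] in [D].
    The balls are traces of open sets [W], which are disjoint as [D] is dense, so cellularity bounds
    [E n]. The union of all [E n] is dense. *)
Lemma metrizable_dense_card (R : realType) (Z : topologicalType) (K : Type)
  (D : set Z) : infinite_set [set: K] ->
  (forall U : set (set Z), cellular_family U -> U #<= [set: K]) ->
  dense D -> metrizable_subspace R D ->
  exists E : set Z, dense E /\ E #<= [set: K].
Proof.
move=> infK cZ dD [d [d0 [dxx [dsym [dtri dtop]]]]].
have [k0 _] := infinite_setN0 infK.
pose B n x := [set y | D y /\ d x y < n.+1%:R^-1].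
have Bx n x : D x -> B n x x.
  by move=> Dx; split=> //; rewrite (dxx x x Dx Dx).2.
have /choice[W WP] : forall nx, exists O, D nx.2 -> open O /\ B nx.1 nx.2 = D `&` O.
  move=> [n x] /=; have [Dx|nDx] := pselect (D x); last by exists setT.
  have BD : B n x `<=` D by move=> y [].
  have [V [oV e]] : exists V, open V /\ B n x = D `&` V; last by exists V.
  apply/(dtop _ BD) => y [Dy xy]; exists (n.+1%:R^-1 - d x y); split.
    by rewrite subr_gt0.
  move=> z [Dz yz]; split=> //; apply: le_lt_trans (dtri x y z Dx Dy Dz) _.
  by rewrite -ltrBrDl.
have Wmeet n x y : D x -> D y -> W (n, x) `&` W (n, y) !=set0 ->
    B n x `&` B n y !=set0.
  move=> Dx Dy Wxy; have [oWx ex] := WP (n, x) Dx; have [oWy ey] := WP (n, y) Dy.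
  have [z [[Wz Wz'] Dz]] := dD _ Wxy (openI oWx oWy).
  by exists z; rewrite [B n x]ex [B n y]ey.
have WB n x : D x -> W (n, x) x.
  move=> Dx; have [_ /= e] := WP (n, x) Dx.
  by have := Bx n x Dx; rewrite e => -[].
pose E n := sval (ex_maximal_disjoint_subcollection (B n) D).
have EP n : [/\ E n `<=` D, trivIset (E n) (B n) &
    forall C, E n `<` C -> C `<=` D -> ~ trivIset C (B n)].
  exact: svalP (ex_maximal_disjoint_subcollection (B n) D).
have ED n x : E n x -> D x by have [sED _ _] := EP n => /sED.
have EW n x y : E n x -> E n y -> W (n, x) `&` W (n, y) !=set0 -> x = y.
  move=> Ex Ey Wxy; have [_ tB _] := EP n.
  by apply: tB => //; apply: (Wmeet n x y (ED _ _ Ex) (ED _ _ Ey)) => //.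
have /choice[j jI] : forall n, exists j : Z -> K,
    forall x y, E n x -> E n y -> j x = j y -> x = y.
  move=> n; apply/(card_leT_injP _ k0).
  have Wcell : cellular_family [set W (n, x) | x in E n].
    split=> [_ [x Ex <-]|_ _ [x Ex <-] [y Ey <-] xy].
      split; first by have [] := WP (n, x) (ED _ _ Ex).
      by exists x; apply: WB; exact: ED Ex.
    by apply: contrapT => /eqP/set0P/(EW _ _ _ Ex Ey) e; apply: xy; rewrite e.
  apply: card_le_trans (cZ _ Wcell).
  have /card_eqPle[] : [set W (n, x) | x in E n] #= E n; last by [].
  apply: inj_card_eq => x y; rewrite !inE => Ex Ey e; apply: (EW n) => //.
  by exists x; rewrite -e setIid; apply: WB; exact: ED Ex.
exists (\bigcup_n E n); split.
  move=> V V0 oV; have [y [Vy Dy]] := dD _ V0 oV.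
  have [|e [e0 eV]] := (dtop (D `&` V) (@subIsetl _ _ _)).1 _ y (conj Dy Vy).
    by exists V.
  have [n ne] : exists n, n.+1%:R^-1 < e / 2.
    exists (Num.truncn (e / 2)^-1); rewrite invf_plt ?posrE ?divr_gt0//.
    by rewrite truncnS_gt.
  (* By maximality the ball around [y] meets a ball with centre in [E n]; that centre is then within
     [e] of [y]. *)
  have [x [Ex [z [[Dz xz] [_ yz]]]]] : exists x, E n x /\ B n x `&` B n y !=set0.
    have [Ey|nEy] := pselect (E n y).
      by exists y; split=> //; exists y; rewrite setIid; exact: Bx.
    apply: contrapT => nx; have [sED tB Emax] := EP n.
    apply: (Emax (E n `|` [set y])).
    - split=> [?|sub]; first by left.
      by apply: nEy; apply: sub; right.
    - by move=> t [/sED//|->].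
    - move=> s t [Es|->] [Et|->] st //; first exact: tB.
        by case: nx; exists s.
      by case: nx; exists t; rewrite setIC.
  have Dx := ED _ _ Ex.
  have /eV[_ Vx] : D x /\ d y x < e.
    split=> //; apply: le_lt_trans (dtri y z x Dy Dz Dx) _.
    by rewrite (dsym z x)// (splitr e) ltrD// (lt_trans _ ne).
  by exists x; split=> //; exists n.
apply: (@card_leT_injects _ infK _ (nat * K)).
  by apply: injects_prod => //; [exact: injects_countType|exists id].
have /choice[m mP] : forall x, exists n, (\bigcup_n E n) x -> E n x.
  move=> x; have [[n _ Ex]|nx] := pselect ((\bigcup_n E n) x); first by exists n.
  by exists 0%N.
apply/(card_leT_injP _ (0%N, k0)); exists (fun x => (m x, j (m x) x)) => x y Ex Ey [mxy].
by rewrite -mxy; apply: jI; [exact: mP|rewrite mxy; exact: mP].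
Qed.

Lemma dense_ptws_proj (I : Type) (T : topologicalType) (i : I) (E : set {ptws I -> T}) :
  dense E -> dense ((fun z : {ptws I -> T} => z i) @` E).
Proof.
move=> dE V [v Vv] oV.
have oV' : open ((fun z : {ptws I -> T} => z i) @^-1` V).
  by apply: (@open_comp {ptws I -> T} T) => // z _; exact: ptws_proj_continuous.
have [|z [Vz Ez]] := dE _ _ oV'; first by exists (fun=> v).
by exists (z i); split=> //; exists z.
Qed.

(** * Families of countable sets *)

Section Enumeration.
Variables (K : choiceType) (F : set (set K)) (e : set K -> nat -> K).
Hypothesis eP : forall A, F A -> range (e A) = A.

Definition enum_const : set (nat -> K) := e @` F `|` range (fun k => fun=> k).

(** The members of [F] enumerated in [G] have their union inside [C], so local countability leaves
    only countably many; the constants in [G] are indexed by [C]. *)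
Lemma enum_const_countable (G : set (nat -> K)) : locally_countable F ->
  G `<=` enum_const -> countable (\bigcup_(s in G) range s) -> countable G.
Proof.
move=> lF GS; set C := \bigcup_(s in G) range s => cC.
pose G' := [set A | F A /\ G (e A)].
have cG' : countable G'.
  apply: contrapT => /(lF _ (fun A => @proj1 _ _)); apply.
  apply: sub_countable cC; apply: subset_card_le => k [A [FA GA] Ak].
  by exists (e A) => //; rewrite eP.
pose H (b : bool) := if b then e @` G' else (fun k => fun=> k) @` C.
apply: (@sub_countable _ _ _ (\bigcup_(b in [set: bool]) H b)).
  apply: subset_card_le => s Gs; have [[A FA As]|[k _ ks]] := GS _ Gs.
    by exists true => //; exists A => //; split=> //; rewrite As.
  exists false => //; exists k => //; exists s => //.
  by rewrite -ks; exists 0%N.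
apply: bigcup_countable => // -[] _; apply: sub_countable (card_image_le _ _) _ => //.
Qed.

Lemma enum_const_card : infinite_set [set: K] ->
  enum_const #<= [set: K] -> F #<= [set: K].
Proof.
move=> infK; have [k0 _] := infinite_setN0 infK.
move=> /(card_leT_injP _ k0)[j jI]; apply/(card_leT_injP _ k0).
exists (j \o e) => A B FA FB /jI AB; rewrite -(eP FA) -(eP FB) AB//.
  by left; exists A.
by left; exists B.
Qed.

End Enumeration.

Lemma countable_subsets_enum (K : Type) (A : set K) :
  countable_subsets A -> exists e : nat -> K, range e = A.
Proof.
move=> [cA iA]; have [A0|/surjfunPex[e ->]] := elimT pfcard_geP cA.
  by case: iA; rewrite A0.
by exists e.
Qed.

Lemma locally_countable_Corson (R : realType) (K : choiceType) (F : set (set K)) :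
  infinite_set [set: K] ->
  F `<=` @countable_subsets K -> locally_countable F -> ~ (F #<= [set: K]) ->
  exists X : topologicalType,
    Corson_compact R X /\
    cellularity_eq {ptws nat -> X} K /\
    density_gt X K /\
    ~ (exists D : set {ptws nat -> X},
         dense D /\ metrizable_subspace R D).
Proof.
move=> infK Fc lF FK; have [k0 _] := infinite_setN0 infK.
have /choice[e eP] : forall A, exists e : nat -> K, F A -> range e = A.
  move=> A; have [/Fc/countable_subsets_enum[e eA]|nF] := pselect (F A).
    by exists e.
  by exists (fun=> k0).
pose S := enum_const F e.
have cS G := @enum_const_countable _ _ _ eP G lF.
have cX := slim_space_Corson R cS.
have cZ (U : set (set {ptws nat -> set_type (slim_space R S)})) :=
  @slim_cellular_le R K S U infK.
have dX : density_gt (set_type (slim_space R S)) K.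
  by apply: slim_density => // /(enum_const_card eP infK).
exists (set_type (slim_space R S)); split=> //; split; last split=> //.
  by split=> // M nM UM; apply: nM; apply: const_cellular UM => k; right; exists k.
move=> [D [dD mD]]; have [E [dE EK]] := metrizable_dense_card infK cZ dD mD.
apply: (dX _ (dense_ptws_proj 0%N dE)).
exact: card_le_trans (card_image_le _ _) EK.
Qed.

Local Close Scope ring_scope.

Theorem mainTheorem8 (R : realType) (K : Type) :
  singular_countable_cof K ->
  (exists F : set (set K),
     F `<=` @countable_subsets K /\ locally_countable F /\
     ~ (F #<= [set: K])) ->
  exists X : topologicalType,
    Corson_compact R X /\
    cellularity_eq {ptws nat -> X} K /\
    density_gt X K /\
    ~ (exists D : set {ptws nat -> X},
         dense D /\ metrizable_subspace R D).
Proof.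
move=> [uncK _] [F [Fc [lF FK]]].
(* [{classic K}] supplies the choice structure; [K] is infinite because it is uncountable. *)
by apply: (@locally_countable_Corson R {classic K} F) => // /finite_set_countable.
Qed.
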